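(* Let $m\ge 1$ and $Q\ge 0$ be integers, and let $\mathcal{S}_Q=\{s\in\mathbb{N}^m : s_i\le Q \text{ for all } i=1,\dots,m\}$. For a real matrix $A\in\mathbb{R}^{(m+1)\times m}$ and a state $s\in\mathbb{N}^m$, let $\pi(A)(s)=\mathrm{softmax}(As)\in\mathbb{R}^{m+1}$, where $\mathrm{softmax}(z)_j=e^{z_j}/\sum_{k=1}^{m+1}e^{z_k}$; this is a probability distribution over the $m+1$ actions $\{1,\dots,m+1\}$ (action $i\le m$ means serving queue $i$, action $m+1$ means idling). Let the priority policy $\pi_P$ be the deterministic policy which, at a state $s\in\mathbb{N}^m$ with $s\neq 0$, chooses action $j(s)=\min\{i : s_i>0\}$ with probability one, i.e. $\pi_P(s)=e_{j(s)}$, the $j(s)$-th standard unit vector of $\mathbb{R}^{m+1}$. For $k\ge 0$ define $A_k\in\mathbb{R}^{(m+1)\times m}$ by $(A_k)_{ii}=(Q+1)^{m-i+1}k+1$ for $i=1,\dots,m$ and $(A_k)_{il}=1$ for all other entries (including the whole last row $i=m+1$), and let $\pi_k=\pi(A_k)$. Then: (1) $\pi_0$ is the uniform policy: $\pi_0(s)=\frac{1}{m+1}(1,\dots,1)^\top$ for every $s\in\mathbb{N}^m$. (2) For every $s\in\mathcal{S}_Q$ with $s\neq 0$, $\pi_k(s)\to\pi_P(s)$ as $k\to\infty$. (3) There is no sequence of matrices $A'_k\in\mathbb{R}^{(m+1)\times m}$ with uniformly bounded entries (i.e. $\sup_k\max_{i,l}|(A'_k)_{il}|<\infty$) such that $\pi(A'_k)(s)\to\pi_P(s)$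 as $k\to\infty$ for every $s\in\mathcal{S}_Q$ with $s\neq 0$.
   Context: Setting: a single-server system with $m$ parallel queues; the observable state $s\in\mathbb{N}^m$ records the number of jobs in each queue, and queues are indexed so that $c_1\mu_1\ge c_2\mu_2\ge\dots\ge c_m\mu_m$ (holding cost $c_i$, service rate $\mu_i$), so the priority ($c$-$\mu$) policy serves the lowest-indexed nonempty queue. Policies are parameterized linearly through a softmax as in the claim. *)

(* Defs.v *)
From HB Require Import structures.
From mathcomp Require Import all_boot all_order all_algebra.
From mathcomp Require Import all_classical all_reals all_analysis.
Set Implicit Arguments. Unset Strict Implicit. Unset Printing Implicit Defensive.
Import Order.TTheory GRing.Theory Num.Theory.
Local Open Scope ring_scope.

(* Indexing is 0-based: queues are 'I_m (paper's queue i is our i-1),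
   actions are 'I_m.+1, the last action ord_max (paper's m+1) is idling.
   A state is s : 'I_m -> nat. *)

Definition linscore (R : realType) (m : nat) (A : 'M[R]_(m.+1, m))
  (s : 'I_m -> nat) (j : 'I_m.+1) : R :=
  \sum_(l < m) A j l * (s l)%:R.

Definition softmax_policy (R : realType) (m : nat) (A : 'M[R]_(m.+1, m))
  (s : 'I_m -> nat) (j : 'I_m.+1) : R :=
  expR (linscore A s j) / \sum_(k < m.+1) expR (linscore A s k).

Definition in_SQ (m Q : nat) (s : 'I_m -> nat) : Prop := forall i, (s i <= Q)%N.

Definition nonzero_state (m : nat) (s : 'I_m -> nat) : Prop := exists i, s i <> 0%N.

Definition is_first_nonempty (m : nat) (s : 'I_m -> nat) (j : 'I_m.+1) : bool :=
  [exists i : 'I_m, [&& nat_of_ord i == nat_of_ord j, (0 < s i)%N &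
     [forall i' : 'I_m, (nat_of_ord i' < nat_of_ord j)%N ==> (s i' == 0%N)]]].

Definition priority_policy (R : realType) (m : nat) (s : 'I_m -> nat)
  (j : 'I_m.+1) : R :=
  if is_first_nonempty s j then 1 else 0.

(* A_k: diagonal entry (paper's i = our i+1) (Q+1)^(m-i+1) k + 1, all others 1 *)
Definition Ak (R : realType) (m Q : nat) (k : nat) : 'M[R]_(m.+1, m) :=
  \matrix_(i < m.+1, l < m)
    if nat_of_ord i == nat_of_ord l
    then ((Q.+1) ^ (m - i))%:R * k%:R + 1
    else 1.

(* Main.v *)
(* Under [Ak k] the score of action [j] is [\sum_l s_l + k * w_j], where
   [w_j = (Q+1)^(m-j) s_j] for a queue and [w = 0] for idling.  Since every
   [s_l <= Q], the weights compare like numbers written in base [Q+1], so the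
   first nonempty queue carries the strictly largest weight and the softmax of
   [k * w] concentrates on it as [k] grows; at [k = 0] all scores coincide.
   Conversely, if all entries are bounded by [C], every score at a fixed state
   [s] lies in [[-B, B]] with [B = C * \sum_l s_l], so every action keeps
   probability at least [exp(-2B)/(m+1)]; in particular idling, which the
   priority policy never chooses, does so at the state with a single job in
   queue 1. *)

Require Import Defs.
From HB Require Import structures.
From mathcomp Require Import all_boot all_order all_algebra.
From mathcomp Require Import all_classical all_reals all_analysis.
Set Implicit Arguments. Unset Strict Implicit. Unset Printing Implicit Defensive.
Import Order.TTheory GRing.Theory Num.Theory numFieldTopology.Exports numFieldNormedType.Exports.
Local Open Scope ring_scope.
Local Open Scope classical_set_scope.

Definition softmax (R : realType) (N : nat) (z : 'I_N -> R) (k : 'I_N) : R :=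
  expR (z k) / \sum_(k' < N) expR (z k').

Section Softmax.
Variables (R : realType) (N : nat).
Implicit Types (z : 'I_N -> R) (k : 'I_N).

Lemma softmax_denom_ge z k : expR (z k) <= \sum_(k' < N) expR (z k').
Proof. by rewrite (bigD1 k) //= lerDl sumr_ge0 // => i _; exact: expR_ge0. Qed.

Lemma softmax_denom_gt0 z k : 0 < \sum_(k' < N) expR (z k').
Proof. exact: lt_le_trans (expR_gt0 _) (softmax_denom_ge z k). Qed.

Lemma softmax_ge0 z k : 0 <= softmax z k.
Proof. by rewrite divr_ge0 ?expR_ge0 ?(ltW (softmax_denom_gt0 z k)). Qed.

Lemma softmax_sum z k : \sum_(k' < N) softmax z k' = 1.
Proof. by rewrite -mulr_suml divff // gt_eqF // (softmax_denom_gt0 z k). Qed.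

Lemma softmax_shift (a : R) z : softmax (fun k => a + z k) =1 softmax z.
Proof.
move=> k; rewrite /softmax; under eq_bigr do rewrite expRD.
by rewrite -mulr_sumr expRD invfM mulrACA divff ?gt_eqF ?expR_gt0 // mul1r.
Qed.

Lemma softmax_cst (a : R) k : softmax (fun=> a) k = N%:R^-1.
Proof.
by rewrite /softmax sumr_const card_ord -[_ *+ N]mulr_natr invfM mulVKf ?gt_eqF ?expR_gt0.
Qed.

Lemma softmax_ge_bounded (B : R) z k : (forall k', `|z k'| <= B) ->
  expR (- B) / (N%:R * expR B) <= softmax z k.
Proof.
move=> zB; have /andP[zk_lo _] : - B <= z k <= B by rewrite -ler_norml.
have den_le : \sum_(k' < N) expR (z k') <= N%:R * expR B.
  apply: le_trans (_ : _ <= \sum_(k' < N) expR B) _; last first.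
    by rewrite sumr_const card_ord mulr_natl.
  by apply: ler_sum => k' _; rewrite ler_expR; move: (zB k'); rewrite ler_norml => /andP[].
have D_gt0 := softmax_denom_gt0 z k.
rewrite /softmax ler_pM ?expR_ge0 ?invr_ge0 ?ler_expR //.
by rewrite lef_pV2 ?posrE // (lt_le_trans D_gt0).
Qed.
End Softmax.

Section SoftmaxConcentration.
Variables (R : realType) (N : nat) (c : 'I_N -> R).

Lemma softmax_scaled_cvg0 k j : c k < c j ->
  (fun n : nat => softmax (fun i => n%:R * c i) k) @ \oo --> (0 : R).
Proof.
move=> ckj.
apply: (@squeeze_cvgr _ _ _ _ (cst 0) (fun n => expR (c k - c j) ^+ n)).
- apply: nearW => n; rewrite softmax_ge0 /=.
  rewrite ler_pdivrMr ?(softmax_denom_gt0 (fun i => n%:R * c i) j) // -expRM_natl.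
  apply: le_trans (ler_wpM2l (expR_ge0 _) (softmax_denom_ge (fun i => n%:R * c i) j)).
  by rewrite -expRD -mulrDr subrK.
- exact: cvg_cst.
- by apply: cvg_expr; rewrite ger0_norm ?expR_ge0 // expR_lt1 subr_lt0.
Qed.

Lemma softmax_scaled_cvg j : (forall k, k != j -> c k < c j) ->
  forall k, (fun n : nat => softmax (fun i => n%:R * c i) k) @ \oo --> ((k == j)%:R : R).
Proof.
move=> c_argmax k; have [->|kj] := eqVneq k j; last first.
  exact: softmax_scaled_cvg0 (c_argmax k kj).
have -> : (fun n => softmax (fun i => n%:R * c i) j) =
          (fun n => 1 - \sum_(k' < N | k' != j) softmax (fun i => n%:R * c i) k').
  apply/funext => n; apply/esym/eqP.
  by rewrite subr_eq -{1}(softmax_sum (fun i => n%:R * c i) j) (bigD1 j).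
suff : (fun n => 1 - \sum_(k' < N | k' != j) softmax (fun i => n%:R * c i) k') @ \oo -->
       (1 - \sum_(k' < N | k' != j) 0 : R) by rewrite big1 ?subr0.
apply: cvgB; first exact: cvg_cst.
apply: cvg_big => [|k' k'j]; first exact: add_continuous.
exact: softmax_scaled_cvg0 (c_argmax k' k'j).
Qed.
End SoftmaxConcentration.

Lemma pow_digit_lt (b x y p q : nat) :
  (x < b)%N -> (0 < y)%N -> (p < q)%N -> (b ^ p * x < b ^ q * y)%N.
Proof.
move=> xb y_gt0 pq; have b_gt0 : (0 < b)%N by apply: leq_ltn_trans xb.
rewrite -(@ltn_pmul2l (b ^ p)) ?expn_gt0 ?b_gt0 // -expnSr in xb.
by apply: leq_trans xb (leq_trans (leq_pexp2l b_gt0 pq) (leq_pmulr _ y_gt0)).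
Qed.

Definition priority_weight (m Q : nat) (s : 'I_m -> nat) (j : 'I_m.+1) : nat :=
  \sum_(l < m | j == l :> nat) Q.+1 ^ (m - j) * s l.

Section PriorityWeight.
Variables (m Q : nat) (s : 'I_m -> nat).

Lemma priority_weight_queue (i : 'I_m) :
  priority_weight Q s (lift ord_max i) = (Q.+1 ^ (m - i) * s i)%N.
Proof.
by rewrite /priority_weight (big_pred1 i) lift_max // => l; rewrite lift_max eq_sym.
Qed.

Lemma priority_weight_idle : priority_weight Q s ord_max = 0%N.
Proof. by rewrite /priority_weight big_pred0 // => l; exact: gtn_eqF (ltn_ord l). Qed.

Lemma linscore_Ak (R : realType) k j : linscore (Ak R m Q k) s j =
  \sum_(l < m) (s l)%:R + k%:R * (priority_weight Q s j)%:R.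
Proof.
rewrite /linscore /priority_weight natr_sum mulr_sumr [in X in _ + X]big_mkcond.
rewrite -big_split.
apply: eq_bigr => l _ /=; rewrite mxE; case: eqP => _; last by rewrite mul1r addr0.
by rewrite natrM mulrDl mul1r addrC mulrCA mulrA.
Qed.

Lemma softmax_policy_Ak (R : realType) k : softmax_policy (Ak R m Q k) s =1
  softmax (fun j => k%:R * (priority_weight Q s j)%:R).
Proof.
move=> j; rewrite -(softmax_shift (\sum_(l < m) (s l)%:R)) /softmax_policy /softmax.
by under eq_bigr do rewrite linscore_Ak; rewrite linscore_Ak.
Qed.
End PriorityWeight.

Section FirstNonempty.
Variables (m : nat) (s : 'I_m -> nat).

Lemma is_first_nonemptyP j : reflect
  (exists2 i : 'I_m, j = lift ord_max i &
     (0 < s i)%N /\ forall i' : 'I_m, (i' < i)%N -> s i' = 0%N)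
  (is_first_nonempty s j).
Proof.
apply: (iffP existsP) =>
  [[i /and3P[/eqP ij s_i_gt0 /forallP s_lt_i]] | [i -> [s_i_gt0 s_lt_i]]].
  exists i; first by apply: ord_inj; rewrite -ij lift_max.
  by split=> // i' i'i; apply/eqP; move: (s_lt_i i'); rewrite -ij i'i.
exists i; rewrite lift_max eqxx s_i_gt0; apply/forallP => i'.
by apply/implyP => i'i; rewrite s_lt_i.
Qed.

Lemma is_first_nonempty_exists : nonzero_state s -> exists j, is_first_nonempty s j.
Proof.
move=> [i0 /eqP]; rewrite -lt0n => s_i0_gt0.
case: (@arg_minnP _ i0 (fun i => 0 < s i)%N (@nat_of_ord m) s_i0_gt0) => i s_i_gt0 i_min.
exists (lift ord_max i); apply/is_first_nonemptyP; exists i => //; split=> // i' i'i.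
by apply/eqP; rewrite -leqn0 leqNgt; apply: contraTN i'i => /i_min; rewrite -leqNgt.
Qed.

Lemma is_first_nonempty_uniq j j' :
  is_first_nonempty s j -> is_first_nonempty s j' -> j = j'.
Proof.
move=> /is_first_nonemptyP[i -> [s_i_gt0 s_lt_i]].
move=> /is_first_nonemptyP[i' -> [s_i'_gt0 s_lt_i']].
congr lift; apply: val_inj; case: (ltngtP i i') => // [/s_lt_i' | /s_lt_i] s0.
  by rewrite s0 in s_i_gt0.
by rewrite s0 in s_i'_gt0.
Qed.

Lemma priority_policy_first (R : realType) j0 : is_first_nonempty s j0 ->
  forall j, priority_policy R s j = (j == j0)%:R.
Proof.
move=> j0_first j; rewrite /priority_policy.
have [->|jj0] := eqVneq j j0; first by rewrite j0_first.
by case: ifP => // /(is_first_nonempty_uniq j0_first) j0j; rewrite j0j eqxx in jj0.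
Qed.

Lemma priority_policy_idle (R : realType) : priority_policy R s ord_max = 0.
Proof.
rewrite /priority_policy; case: is_first_nonemptyP => // -[i /eqP].
by rewrite (negbTE (neq_lift _ _)).
Qed.

Lemma priority_weight_lt_first Q j0 : in_SQ Q s -> is_first_nonempty s j0 ->
  forall j, j != j0 -> (priority_weight Q s j < priority_weight Q s j0)%N.
Proof.
move=> s_le_Q /is_first_nonemptyP[i -> [s_i_gt0 s_lt_i]] j.
rewrite priority_weight_queue.
have pos : (0 < Q.+1 ^ (m - i) * s i)%N by rewrite muln_gt0 expn_gt0.
case: (unliftP ord_max j) => [i'|] ->; last by rewrite priority_weight_idle.
rewrite priority_weight_queue (inj_eq (@lift_inj _ ord_max)) => i'i.
case: (ltngtP i' i) => [/s_lt_i -> | ii' | /val_inj ii']; first by rewrite muln0.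
  by apply: pow_digit_lt => //; [exact: s_le_Q | rewrite ltn_sub2l].
by rewrite ii' eqxx in i'i.
Qed.
End FirstNonempty.

Section BoundedSoftmaxPolicy.
Variables (R : realType) (m : nat).

Lemma linscore_norm_le (A : 'M[R]_(m.+1, m)) (C : R) s j :
  (forall i l, `|A i l| <= C) -> `|linscore A s j| <= C * \sum_(l < m) (s l)%:R.
Proof.
move=> A_le_C; rewrite /linscore mulr_sumr.
apply: le_trans (ler_norm_sum _ _ _) _; apply: ler_sum => l _.
by rewrite normrM [`|(s l)%:R|]ger0_norm // ler_wpM2r.
Qed.

Lemma softmax_policy_not_cvg0 (A : nat -> 'M[R]_(m.+1, m)) (C : R) s j :
  (forall k i l, `|A k i l| <= C) ->
  ~ (fun k => softmax_policy (A k) s j) @ \oo --> (0 : R).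
Proof.
move=> A_le_C; set B := C * \sum_(l < m) (s l)%:R.
set d := expR (- B) / ((m.+1)%:R * expR B).
have d_gt0 : 0 < d by rewrite divr_gt0 ?expR_gt0 // mulr_gt0 ?expR_gt0.
have d_le k : d <= softmax_policy (A k) s j.
  by apply: softmax_ge_bounded => j'; apply: linscore_norm_le.
move=> /cvgr0_norm_lt /(_ _ d_gt0) [N _ small].
have := small N (leqnn N); rewrite ltNge => /negP; apply.
exact: le_trans (d_le N) (ler_norm _).
Qed.
End BoundedSoftmaxPolicy.

Theorem theorem2 (R : realType) (m Q : nat) (hm : (1 <= m)%N) :
  (* (1) pi_0 is uniform *)
  (forall (s : 'I_m -> nat) (j : 'I_m.+1),
      softmax_policy (Ak R m Q 0) s j = 1 / (m.+1)%:R)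
  /\
  (* (2) pi_k(s) -> pi_P(s) for nonzero s in S_Q *)
  (forall s : 'I_m -> nat, in_SQ Q s -> nonzero_state s ->
     forall j : 'I_m.+1,
       ((fun k : nat => softmax_policy (Ak R m Q k) s j) : nat -> R) @ \oo
         --> (priority_policy R s j : R))
  /\
  (* (3) no uniformly bounded sequence achieves this (needs Q >= 1, see NOTES) *)
  ((1 <= Q)%N ->
   ~ exists A' : nat -> 'M[R]_(m.+1, m),
       (exists C : R, forall k (i : 'I_m.+1) (l : 'I_m), `|A' k i l| <= C) /\
       (forall s : 'I_m -> nat, in_SQ Q s -> nonzero_state s ->
          forall j : 'I_m.+1,
            ((fun k : nat => softmax_policy (A' k) s j) : nat -> R) @ \oo
              --> (priority_policy R s j : R))).
Proof.
split; last split.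
- move=> s j; rewrite softmax_policy_Ak div1r.
  under eq_fun do rewrite mul0r.
  exact: softmax_cst.
- move=> s s_le_Q /is_first_nonempty_exists[j0 j0_first] j.
  rewrite (priority_policy_first _ j0_first).
  under eq_fun do rewrite softmax_policy_Ak.
  apply: softmax_scaled_cvg => j' j'j0.
  by rewrite ltr_nat; exact: priority_weight_lt_first.
- move=> Q_gt0 [A' [[C A'_le_C] A'_cvg]].
  pose s (l : 'I_m) : nat := (val l == 0%N).
  have s_le_Q : in_SQ Q s by move=> l; exact: leq_trans (leq_b1 _) Q_gt0.
  have s_nonzero : nonzero_state s by exists (Ordinal hm).
  apply: (softmax_policy_not_cvg0 (s := s) (j := ord_max) A'_le_C).
  by rewrite -(priority_policy_idle s R); exact: A'_cvg.
Qed.
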